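(* Let $\omega=\exp(2\pi i/3)$, let $H$ be the group of order 54 described in the context, let $\varepsilon\in\{1,-1\}$, $k\in\{0,1\}$, and let $\Pi=R_{\varepsilon;k}$ be the 3-dimensional representation of $H$ (of spin type $\chi_\varepsilon$) defined in the context. Then the trace character $\chi_\Pi$ is given, for $h=z_{12}^{\alpha}\xi_1^{\beta_1}\xi_2^{\beta_2}w^\sigma$ with $0\le\alpha,\beta_1,\beta_2\le2$ and $\sigma\in\{0,1\}$, as follows. In case $\sigma=0$, $$\chi_\Pi(h)=\begin{cases}3\omega^{\alpha\varepsilon}&\text{if }\beta_1=\beta_2=0,\\0&\text{otherwise;}\end{cases}$$ in case $\sigma=1$, $$\chi_\Pi(h)=\begin{cases}\omega^{\alpha\varepsilon}(-1)^k&\text{if }\beta_2=0,\\ \omega^{\alpha\varepsilon}(-1)^k\omega^{-\beta_1\varepsilon}&\text{if }\beta_2=1,\\ \omega^{\alpha\varepsilon}(-1)^k\omega^{\beta_1\varepsilon}&\text{if }\beta_2=2.\end{cases}$$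
   Context: $H$ is the group generated by $\xi_1,\xi_2,z_{12},w$ with fundamental relations $\xi_1^3=\xi_2^3=1$, $z_{12}^3=1$, $w^2=1$, $z_{12}$ central, $\xi_2\xi_1=z_{12}^{-1}\xi_1\xi_2$, $w\xi_iw^{-1}=\xi_i^{-1}$ $(i=1,2)$. Its elements are uniquely written as $z_{12}^{\alpha}\xi_1^{\beta_1}\xi_2^{\beta_2}w^\sigma$ with $0\le\alpha,\beta_1,\beta_2\le2$, $\sigma\in\{0,1\}$. (It is a representation group $R(G)$ of the group $G=(C_3\times C_3)\rtimes C_2$ of order 18 in which the generator of $C_2$ acts by inversion.) Spin type $\chi_\varepsilon$ of a representation $\Pi$ of $H$ means $\Pi(z_{12})=\omega^\varepsilon I$. For $\varepsilon=\pm1$ and $k\in\{0,1\}$, $R_{\varepsilon;k}$ is the 3-dimensional representation of $H$ given by $$R_{\varepsilon;k}(z_{12})=\omega^\varepsilon I_3,\quad R_{\varepsilon;k}(\xi_1)=\begin{bmatrix}\omega^\varepsilon&0&0\\0&1&0\\0&0&\omega^{-\varepsilon}\end{bmatrix},\quad R_{\varepsilon;k}(\xi_2)=\begin{bmatrix}0&1&0\\0&0&1\\1&0&0\end{bmatrix},\quad R_{\varepsilon;k}(w)=(-1)^k\begin{bmatrix}0&0&1\\0&1&0\\1&0&0\end{bmatrix}.$$ *)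

(* Defs.v *)
From HB Require Import structures.
From mathcomp Require Import all_boot all_order all_algebra all_fingroup.
From mathcomp Require Import mxrepresentation complex ring.
From mathcomp Require Import reals sequences exp trigo.

Set Implicit Arguments.
Unset Strict Implicit.
Unset Printing Implicit Defensive.

Import Order.TTheory GRing.Theory Num.Theory.

Local Open Scope ring_scope.

(* The group H, built on its normal forms:
   [NF a b c s] stands for z12 ^ a * xi1 ^ b * xi2 ^ c * w ^ s.
   [H_universal] below shows that this is the group presented by the
   generators xi1, xi2, z12, w and the relations of [Hgroup_relations]. *)
Record Hgroup := NF { nf_z : 'Z_3; nf_1 : 'Z_3; nf_2 : 'Z_3; nf_w : bool }.

Definition Hgroup_tuple (h : Hgroup) := (nf_z h, nf_1 h, nf_2 h, nf_w h).
Definition Hgroup_of_tuple (t : 'Z_3 * 'Z_3 * 'Z_3 * bool) :=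
  NF t.1.1.1 t.1.1.2 t.1.2 t.2.

Lemma Hgroup_tupleK : cancel Hgroup_tuple Hgroup_of_tuple.
Proof. by case. Qed.

Lemma Hgroup_of_tupleK : cancel Hgroup_of_tuple Hgroup_tuple.
Proof. by case=> [[[]]]. Qed.

HB.instance Definition _ := Finite.copy Hgroup (can_type Hgroup_tupleK).

(* Moving w ^ s past xi_i ^ b inverts xi_i ^ b when s is odd; moving xi2 ^ c
   past xi1 ^ b produces the central factor z12 ^ (- c * b). *)
Definition Hsgn (s : bool) (x : 'Z_3) : 'Z_3 := if s then - x else x.

Definition Hmul (g h : Hgroup) : Hgroup :=
  NF (nf_z g + nf_z h - nf_2 g * Hsgn (nf_w g) (nf_1 h))
     (nf_1 g + Hsgn (nf_w g) (nf_1 h))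
     (nf_2 g + Hsgn (nf_w g) (nf_2 h))
     (nf_w g (+) nf_w h).

Definition Hone : Hgroup := NF 0 0 0 false.

Definition Hinv (h : Hgroup) : Hgroup :=
  NF (- nf_z h - nf_2 h * nf_1 h)
     (- Hsgn (nf_w h) (nf_1 h))
     (- Hsgn (nf_w h) (nf_2 h))
     (nf_w h).

Lemma HmulA : associative Hmul.
Proof.
case=> [a b c s] [a' b' c' s'] [a2 b2 c2 s2]; rewrite /Hmul /Hsgn /= addbA.
by case: s; case: s' => /=; congr NF; ring.
Qed.

Lemma Hmul1 : left_id Hone Hmul.
Proof. by case=> [a b c s]; rewrite /Hmul /Hsgn /=; congr NF; ring. Qed.

Lemma HmulV : left_inverse Hone Hinv Hmul.
Proof.
case=> [a b c s]; rewrite /Hmul /Hinv /Hone /Hsgn /=.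
by case: s => /=; congr NF; ring.
Qed.

HB.instance Definition _ := Finite_isGroup.Build Hgroup HmulA Hmul1 HmulV.

Definition z12 : Hgroup := NF 1 0 0 false.
Definition xi1 : Hgroup := NF 0 1 0 false.
Definition xi2 : Hgroup := NF 0 0 1 false.
Definition w : Hgroup := NF 0 0 0 true.

Lemma z12X n : (z12 ^+ n)%g = NF n%:R 0 0 false.
Proof.
elim: n => // n IHn; rewrite expgS IHn; congr NF; rewrite /=.
- by rewrite mul0r subr0 -natr1 addrC.
- by rewrite addr0.
- by rewrite addr0.
Qed.

Lemma xi1X n : (xi1 ^+ n)%g = NF 0 n%:R 0 false.
Proof.
elim: n => // n IHn; rewrite expgS IHn; congr NF; rewrite /=.
- by rewrite mul0r subr0 addr0.
- by rewrite -natr1 addrC.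
- by rewrite addr0.
Qed.

Lemma xi2X n : (xi2 ^+ n)%g = NF 0 0 n%:R false.
Proof.
elim: n => // n IHn; rewrite expgS IHn; congr NF; rewrite /=.
- by rewrite mulr0 subr0 addr0.
- by rewrite addr0.
- by rewrite -natr1 addrC.
Qed.

Lemma normal_formE (a b c : nat) (s : bool) :
  (z12 ^+ a * xi1 ^+ b * xi2 ^+ c * w ^+ s)%g = NF a%:R b%:R c%:R s.
Proof.
rewrite z12X xi1X xi2X.
have -> : (w ^+ s)%g = NF 0 0 0 s by case: s.
by congr NF; rewrite /= /Hsgn /=; ring.
Qed.

Lemma Hgroup_normal_form (h : Hgroup) : exists! t : 'I_3 * 'I_3 * 'I_3 * 'I_2,
  h = (z12 ^+ t.1.1.1 * xi1 ^+ t.1.1.2 * xi2 ^+ t.1.2 * w ^+ t.2)%g.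
Proof.
case: h => a b c s.
have sE (i : 'I_2) : i = (i != 0) :> nat by case: i => [[|[]]].
exists (a, b, c, if s then 1 else 0); split => [|[[[a' b'] c'] s']] /=.
  have -> : nat_of_ord (if s then 1 else 0 : 'I_2) = s by case: s.
  by rewrite normal_formE !natr_Zp.
rewrite (sE s') normal_formE !natr_Zp => -[-> -> ->] ->.
by congr (_, _); apply/val_inj; rewrite /= [RHS]sE; case: eqP.
Qed.

Lemma card_Hgroup : #|{: Hgroup}| = 54.
Proof.
rewrite (bij_eq_card (Bijective Hgroup_tupleK Hgroup_of_tupleK)).
by rewrite !card_prod !card_ord card_bool.
Qed.

Lemma Hgroup_relations :
  [/\ xi1 ^+ 3 = 1, xi2 ^+ 3 = 1, z12 ^+ 3 = 1 & w ^+ 2 = 1]%g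
  /\ [/\ commute z12 xi1, commute z12 xi2 & commute z12 w]
  /\ [/\ xi2 * xi1 = z12^-1 * xi1 * xi2,
         w * xi1 * w^-1 = xi1^-1 & w * xi2 * w^-1 = xi2^-1]%g.
Proof. by do !split; apply/eqP. Qed.

(* Evaluation of normal forms in a monoid whose elements z, x, y, t satisfy
   the relations of H. *)
Section Evaluation.
Variables (M : Type) (e : M) (op : M -> M -> M).
Hypotheses (opA : associative op) (op1 : left_id e op) (opr1 : right_id e op).

Let pw x n := iter n (op x) e.

Variables z x y t : M.
Hypotheses (z3 : pw z 3 = e) (x3 : pw x 3 = e) (y3 : pw y 3 = e).
Hypotheses (t2 : op t t = e).
Hypotheses (zx : op z x = op x z) (zy : op z y = op y z) (zt : op z t = op t z).
Hypotheses (xy : op x y = op z (op y x)).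
Hypotheses (tx : op (op t x) t = op x x) (ty : op (op t y) t = op y y).

Definition NFeval (h : Hgroup) : M :=
  op (pw z (nf_z h)) (op (pw x (nf_1 h)) (op (pw y (nf_2 h)) (pw t (nf_w h)))).

Let pwD u m n : pw u (m + n)%N = op (pw u m) (pw u n).
Proof. by elim: m => [|m IHm] /=; rewrite ?op1 // -opA -IHm. Qed.

Let pwmod u n : pw u 3 = e -> pw u (n %% 3)%N = pw u n.
Proof.
move=> u3; rewrite [in RHS](divn_eq n 3) pwD; elim: (n %/ 3)%N => [|m].
  by rewrite op1.
by rewrite mulSn pwD u3 op1.
Qed.

Let pwZD u (a b : 'Z_3) : pw u 3 = e ->
  pw u (a + b : 'Z_3)%R = op (pw u a) (pw u b).
Proof. by move=> u3; rewrite -pwD -[RHS]pwmod. Qed.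

Let comm_pw u v n : op u v = op v u -> op u (pw v n) = op (pw v n) u.
Proof.
by move=> uv; elim: n => [|n IHn] /=; rewrite ?op1 // opA uv -!opA IHn.
Qed.

Let comm_pw2 u v m n : op u v = op v u ->
  op (pw u m) (pw v n) = op (pw v n) (pw u m).
Proof. by move=> uv; apply: comm_pw; apply/esym/comm_pw. Qed.

Let zC a s : op (pw t s) (pw z a) = op (pw z a) (pw t s).
Proof. exact/comm_pw2/esym. Qed.

Let t_inv u n : op (op t u) t = op u u -> op t (pw u n) = op (pw u (n + n)%N) t.
Proof.
move=> tu; have tuE : op t u = op (op u u) t.
  by rewrite -tu -!opA t2 opr1.
elim: n => [|n IHn] /=; first by rewrite opr1 op1.
by rewrite opA tuE -opA IHn addnS /= !opA.
Qed.

Let t_pw u (s : bool) (n : 'Z_3) : pw u 3 = e -> op (op t u) t = op u u ->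
  op (pw t s) (pw u n) = op (pw u (Hsgn s n)) (pw t s).
Proof.
move=> u3 tu; case: s => /=; last by rewrite op1 opr1.
rewrite opr1 t_inv // -(@pwmod _ (nat_of_ord n + nat_of_ord n)%N) //; congr (op (pw u _) t).
by case: n => [[|[|[]]]].
Qed.

Let yx_pw (c b : 'Z_3) :
  op (pw y c) (pw x b) = op (pw z (- (c * b) : 'Z_3)%R) (op (pw x b) (pw y c)).
Proof.
have y1 n : op y (pw x n) = op (pw z (n + n)%N) (op (pw x n) y).
  have yx : op y x = op (op z z) (op x y).
    have zzz : op (op z z) z = e by rewrite -z3 /= opr1 opA.
    by rewrite xy !opA zzz op1.
  elim: n => [|n IHn] /=; first by rewrite opr1 !op1.
  rewrite opA yx -!opA -[op y (iter _ _ _)]/(op y (pw x n)) IHn addnS /= -!opA.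
  congr (op z (op z _)).
  by rewrite opA -[op x _]/(op x (pw z _)) comm_pw // -!opA.
have yn m n : op (pw y m) (pw x n) = op (pw z ((n + n) * m)%N) (op (pw x n) (pw y m)).
  elim: m => [|m IHm]; first by rewrite muln0 /= !op1 opr1.
  rewrite /= -opA IHm opA comm_pw; last exact/esym.
  by rewrite mulnS addnC pwD -!opA; congr op; rewrite opA y1 -!opA.
rewrite yn -pwmod //; congr (op (pw z _) _).
by case: c b => [[|[|[]]]] // ? [[|[|[]]]].
Qed.

Lemma NFevalM (g h : Hgroup) : NFeval (Hmul g h) = op (NFeval g) (NFeval h).
Proof.
case: g h => a b c s [a' b' c' s']; rewrite /NFeval /Hmul; cbn [nf_z nf_1 nf_2 nf_w].
have -> : pw t (s (+) s') = op (pw t s) (pw t s').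
  by case: s; case: s'; rewrite /= ?op1 ?opr1 ?t2.
rewrite !pwZD // -!opA; congr op.
rewrite [in RHS](opA (pw t s)) zC -!opA.
rewrite [in RHS](opA (pw t s) (pw x b')) t_pw // -!opA.
rewrite [in RHS](opA (pw t s) (pw y c')) t_pw // -!opA.
rewrite [in RHS](opA (pw y c) (pw z a')) (comm_pw2 _ _ (esym zy)) -!opA.
rewrite [in RHS](opA (pw x b) (pw z a')) (comm_pw2 _ _ (esym zx)) -!opA.
congr op; rewrite [in RHS](opA (pw y c) (pw x _)) yx_pw -!opA.
by rewrite [in RHS](opA (pw x b) (pw z _)) (comm_pw2 _ _ (esym zx)) -!opA.
Qed.

Lemma NFeval1 : NFeval Hone = e.
Proof. by rewrite /NFeval /= !op1. Qed.

Lemma NFevalE : [/\ NFeval z12 = z, NFeval xi1 = x, NFeval xi2 = y & NFeval w = t].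
Proof. by rewrite /NFeval /= !op1 !opr1. Qed.

End Evaluation.

(* H is universal among all groups, finite or not, with generators satisfying
   its relations; the morphism f is unique by Hgroup_normal_form. *)
Lemma H_universal (K : groupType) (z x1 x2 t : K) :
  [/\ x1 ^+ 3 = 1, x2 ^+ 3 = 1, z ^+ 3 = 1 & t ^+ 2 = 1]%g ->
  [/\ commute z x1, commute z x2 & commute z t] ->
  [/\ x2 * x1 = z^-1 * x1 * x2,
      t * x1 * t^-1 = x1^-1 & t * x2 * t^-1 = x2^-1]%g ->
  exists f : Hgroup -> K,
    {morph f : g h / (g * h)%g}
    /\ [/\ f z12 = z, f xi1 = x1, f xi2 = x2 & f w = t].
Proof.
move=> [x13 x23 z3 t2] [zx1 zx2 zt] [x21 tx1 tx2].
have exp3 (u : K) : (u ^+ 3 = u * (u * u))%g by [].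
have inv2 (u : K) : (u ^+ 3 = 1)%g -> (u^-1 = u * u)%g.
  by move=> u3; rewrite -[LHS]mulg1 -u3 exp3 mulKg.
have it (u : K) : (u ^+ 3 = 1)%g -> iter 3 (mul u) 1%g = 1%g.
  by move=> u3; rewrite /= mulg1 -exp3.
have tt : (t * t = 1)%g by rewrite -t2.
have tV : (t^-1 = t)%g by rewrite -[LHS]mulg1 -tt mulKg.
exists (NFeval 1%g mul z x1 x2 t); split.
  apply: NFevalM => //; try exact: it; try exact: mulgA; try exact: mul1g.
  - exact: mulg1.
  - by rewrite x21 -!mulgA mulKVg.
  - by rewrite -inv2 // -tx1 tV.
  - by rewrite -inv2 // -tx2 tV.
by apply: NFevalE; [exact: mul1g | exact: mulg1].
Qed.

Local Open Scope complex_scope.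

Definition cexp (R : realType) (u : R[i]) : R[i] :=
  let: a +i* b := u in (expR a * cos b) +i* (expR a * sin b).

Lemma cexpD (R : realType) (u v : R[i]) : cexp (u + v) = cexp u * cexp v.
Proof.
case: u v => a b [c d]; rewrite /cexp /= expRD cosD sinD.
by apply/eqP; rewrite eq_complex /=; apply/andP; split; apply/eqP; ring.
Qed.

Definition omega (R : realType) : R[i] := cexp (2 * (pi : R)%:C * 'i / 3).

Lemma omega3 (R : realType) : omega R ^+ 3 = 1.
Proof.
have -> : omega R ^+ 3 = cexp (2 * (pi : R)%:C * 'i).
  rewrite !exprS expr0 mulr1 -!cexpD; congr cexp.
  by field.
have -> : 2 * (pi : R)%:C * 'i = 0 +i* (pi *+ 2).
  by apply/eqP; rewrite eq_complex /=; apply/andP; split; apply/eqP; ring.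
by rewrite /cexp /= expR0 !mul1r cos2pi sin2pi.
Qed.

Definition mx3 (T : Type) (a b c d e f g h i : T) : 'M[T]_3 :=
  \matrix_(r < 3, s < 3)
    tnth (tnth [tuple [tuple a; b; c]; [tuple d; e; f]; [tuple g; h; i]] r) s.

Section SpinRepresentation.
Variables (R : realType) (eps : int) (k : nat).

Local Notation om := (omega R).

(* The representation R_{eps;k}: its values on the four generators, extended
   multiplicatively along normal forms. It is a representation for every
   integer eps and every k. *)
Definition spin_z12 : 'M[R[i]]_3 := (om ^ eps)%:M.

Definition spin_xi1 : 'M[R[i]]_3 :=
  mx3 (om ^ eps) 0 0
      0 1 0
      0 0 (om ^ (- eps)).

Definition spin_xi2 : 'M[R[i]]_3 :=
  mx3 0 1 0
      0 0 1
      1 0 0.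

Definition spin_w : 'M[R[i]]_3 :=
  (-1) ^+ k *: mx3 0 0 1
                   0 1 0
                   1 0 0.

Definition spin_fun (h : Hgroup) : 'M[R[i]]_3 :=
  spin_z12 ^+ nf_z h * spin_xi1 ^+ nf_1 h * spin_xi2 ^+ nf_2 h
  * spin_w ^+ nf_w h.

Lemma mulmx3 (a b c d e f g h i a' b' c' d' e' f' g' h' i' : R[i]) :
  mx3 a b c d e f g h i * mx3 a' b' c' d' e' f' g' h' i' =
  mx3 (a * a' + b * d' + c * g') (a * b' + b * e' + c * h')
      (a * c' + b * f' + c * i')
      (d * a' + e * d' + f * g') (d * b' + e * e' + f * h')
      (d * c' + e * f' + f * i')
      (g * a' + h * d' + i * g') (g * b' + h * e' + i * h')
      (g * c' + h * f' + i * i').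
Proof.
apply/matrixP => r s; rewrite !mxE !big_ord_recl big_ord0 !mxE /= addr0 addrA.
by case: r => [[|[|[]]]] // ?; case: s => [[|[|[]]]].
Qed.

Lemma scalar_mx3 (a : R[i]) : a%:M = mx3 a 0 0 0 a 0 0 0 a.
Proof.
apply/matrixP => r s; rewrite !mxE.
by case: r => [[|[|[]]]] // ?; case: s => [[|[|[]]]].
Qed.

Lemma scale_mx3 (u a b c d e f g h i : R[i]) :
  u *: mx3 a b c d e f g h i =
  mx3 (u * a) (u * b) (u * c) (u * d) (u * e) (u * f) (u * g) (u * h) (u * i).
Proof.
apply/matrixP => r s; rewrite !mxE.
by case: r => [[|[|[]]]] // ?; case: s => [[|[|[]]]].
Qed.

Let X := om ^ eps.
Let Y := om ^ (- eps).
Let s := (-1 : R[i]) ^+ k.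

Let om_neq0 : om != 0.
Proof.
by apply/eqP => om0; have /eqP := omega3 R; rewrite om0 expr0n eq_sym oner_eq0.
Qed.

Let XY : X * Y = 1.
Proof. by rewrite /X /Y -expfzDr // subrr. Qed.

Let XXX : X * X * X = 1.
Proof.
rewrite /X -!expfzDr // (_ : eps + eps + eps = Posz 3 * eps); last by ring.
by rewrite -exprz_exp -exprnP omega3 exp1rz.
Qed.

Let XX : X * X = Y.
Proof. by rewrite -[LHS]mulr1 -XY mulrA XXX mul1r. Qed.

Let YY : Y * Y = X.
Proof. by rewrite -{1}XX -mulrA XY mulr1. Qed.

Let ss : s * s = 1.
Proof. by rewrite /s -exprD addnn -mul2n exprM sqrrN expr1n expr1n. Qed.

Lemma spin_funM : {morph spin_fun : g h / (g * h)%g >-> g * h}.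
Proof.
have XYX : Y * X = 1 by rewrite mulrC.
have iterX (A : 'M[R[i]]_3) n : A ^+ n = iter n ( *%R A) 1.
  by elim: n => [|n IHn]; rewrite ?expr0 // exprS IHn.
have spinE h : spin_fun h = NFeval 1 *%R spin_z12 spin_xi1 spin_xi2 spin_w h.
  by rewrite /spin_fun /NFeval -!iterX -!mulrA.
have [zE xE yE tE] : [/\ spin_z12 = mx3 X 0 0 0 X 0 0 0 X,
    spin_xi1 = mx3 X 0 0 0 1 0 0 0 Y, spin_xi2 = mx3 0 1 0 0 0 1 1 0 0
    & spin_w = mx3 0 0 s 0 s 0 s 0 0].
  by rewrite /spin_z12 /spin_w scalar_mx3 scale_mx3 !mulr0 !mulr1.
have oneE : 1 = mx3 1 0 0 0 1 0 0 0 1 :> 'M[R[i]]_3 by rewrite -scalar_mx3.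
have sE := (mulmx3, mulr0, mul0r, addr0, add0r, mulr1, mul1r).
move=> g h; rewrite !spinE.
apply: NFevalM; rewrite ?zE ?xE ?yE ?tE; try exact: mulrA; try exact: mul1r;
  try exact: mulr1; rewrite /= ?mulr1 ?oneE !sE ?XX ?YY ?XY ?XYX ?ss //.
- by rewrite [X * s]mulrC.
- by rewrite ![s * _]mulrC -!mulrA ss !mulr1.
Qed.

Lemma spin_fun_repr : mx_repr [set: Hgroup] spin_fun.
Proof.
split; first by rewrite /spin_fun /= !expr0 !mulr1.
by move=> g h _ _; apply: spin_funM.
Qed.

Definition spinR : mx_representation R[i] [set: Hgroup] 3 :=
  MxRepresentation spin_fun_repr.

Lemma spinRE :
  [/\ spinR z12 = spin_z12, spinR xi1 = spin_xi1,
      spinR xi2 = spin_xi2 & spinR w = spin_w].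
Proof.
have NFE (a b c : 'Z_3) t : spinR (NF a b c t) =
  spin_z12 ^+ a * spin_xi1 ^+ b * spin_xi2 ^+ c * spin_w ^+ t by [].
by split; rewrite NFE ?expr0 expr1 ?mulr1 ?mul1r.
Qed.

End SpinRepresentation.

Definition trace_character (F : fieldType) (gT : finGroupType) (G : {group gT})
    (n : nat) (rG : mx_representation F G n) (h : gT) : F :=
  \tr (rG h).

(* Main.v *)
Require Import Defs.
From mathcomp Require Import all_boot all_order all_algebra all_fingroup.
From mathcomp Require Import mxrepresentation complex reals.
From mathcomp Require Import exp trigo ring lra.
Import Order.TTheory GRing.Theory Num.Theory.
Local Open Scope ring_scope.

(* On H, the image of h is a monomial matrix, so its trace only sees the fixed
   points of the permutation induced by xi2 ^ beta2 * w ^ sigma on the three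
   basis vectors: a nontrivial power of xi2 has none, and each reflection has
   exactly one. For the identity permutation, the trace of xi1 ^ beta1 is a
   sum of all cube roots of unity unless beta1 = 0. *)

Lemma tr_mx3 (R : realType) (a b c d e f g h i : R[i]) :
  \tr (mx3 a b c d e f g h i) = a + e + i.
Proof. by rewrite /mxtrace !big_ord_recl big_ord0 !mxE /= addr0 addrA. Qed.

(** The angle 2 pi / 3 lies strictly between 0 and pi, so the imaginary part of [omega R] is
    positive. *)
Lemma omega_neq1 (R : realType) : omega R != 1.
Proof.
have argE : (2 * (pi : R)%:C * 'i / 3 = 0 +i* (2 * pi / 3) :> R[i])%C.
  have n3 : (3 : R[i]) != 0 by rewrite pnatr_eq0.
  apply: (mulIf n3); rewrite mulfVK //.
  by apply/eqP; rewrite eq_complex /=; apply/andP; split; apply/eqP; field.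
have sin_gt0 : 0 < sin (2 * pi / 3 : R).
  by apply: sin_gt0_pi; have := @pi_gt0 R => ?; apply/andP; split; lra.
rewrite /omega argE /cexp expR0 !mul1r eq_complex /= negb_and.
by rewrite (gt_eqF sin_gt0) orbT.
Qed.

(** Cancel the nonzero factor [omega R - 1] in the factorization of [omega R ^+ 3 - 1]. *)
Lemma omega_sum (R : realType) : 1 + omega R + omega R ^+ 2 = 0.
Proof.
have n0 : omega R - 1 != 0 by rewrite subr_eq0 omega_neq1.
apply: (mulfI n0); rewrite mulr0.
by transitivity (omega R ^+ 3 - 1); [ring | rewrite omega3 subrr].
Qed.

Lemma omega_unit (R : realType) : omega R \is a GRing.unit.
Proof. by rewrite -(unitrX_pos _ (isT : 0 < 3)%N) omega3 unitr1. Qed.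

Lemma omegaV (R : realType) : (omega R)^-1 = omega R ^+ 2.
Proof.
by apply: (mulrI (omega_unit R)); rewrite divrr ?omega_unit // -exprS omega3.
Qed.

Lemma omega_sum_exp (R : realType) (eps : int) (b : nat) :
  eps = 1 \/ eps = -1 -> (0 < b <= 2)%N ->
  (omega R ^ eps) ^+ b + 1 + (omega R ^ (- eps)) ^+ b = 0.
Proof.
have := omega_sum R; have := omega3 R; set om := omega R => om3 om_sum.
have sum1 : om + 1 + om ^+ 2 = 0 by rewrite -om_sum; ring.
have sum2 : om ^+ 2 + 1 + (om ^+ 2) ^+ 2 = 0.
  by rewrite -exprM (exprS om 3) om3 mulr1 -om_sum; ring.
(* Changing the sign of [eps] only swaps the outer terms, so [sum1] settles exponent 1 and [sum2]
   exponent 2. *)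
case=> ->; case: b => [|[|[|]]] // _; rewrite ?opprK expr1z exprN1 omegaV -/om.
- by [].
- exact: sum2.
- by rewrite -sum1; ring.
- by rewrite -sum2; ring.
Qed.

Lemma spin_xi1X (R : realType) (eps : int) (n : nat) :
  spin_xi1 R eps ^+ n =
  mx3 ((omega R ^ eps) ^+ n) 0 0 0 1 0 0 0 ((omega R ^ (- eps)) ^+ n).
Proof.
elim: n => [|n IHn]; first by rewrite !expr0 -scalar_mx3.
rewrite exprS IHn /spin_xi1 mulmx3 !exprS.
by rewrite !(mulr0, mul0r, addr0, add0r, mulr1).
Qed.

(** The central generator acts by a scalar, which factors out of the trace. *)
Lemma spinR_normal_form (R : realType) (eps : int) (k a b c s : nat) :
  spinR R eps k (z12 ^+ a * xi1 ^+ b * xi2 ^+ c * w ^+ s)%g =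
  (omega R ^ eps) ^+ a *:
    (spin_xi1 R eps ^+ b * spin_xi2 R ^+ c * spin_w R k ^+ s).
Proof.
rewrite !repr_mxM ?inE // !repr_mxX ?inE //.
have [-> -> -> ->] := spinRE R eps k.
by rewrite /spin_z12 -rmorphXn /= mul_scalar_mx -!scalemxAl.
Qed.

Theorem theorem6p5 (R : realType) (eps : int) (k : nat)
    (heps : eps = 1 \/ eps = -1) (hk : (k <= 1)%N)
    (alpha beta1 beta2 sigma : nat)
    (halpha : (alpha <= 2)%N) (hbeta1 : (beta1 <= 2)%N)
    (hbeta2 : (beta2 <= 2)%N) (hsigma : (sigma <= 1)%N) :
  let om := omega R in
  let chi := trace_character (spinR R eps k) in
  let h := (z12 ^+ alpha * xi1 ^+ beta1 * xi2 ^+ beta2 * w ^+ sigma)%g in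
  (sigma = 0%N ->
     ((beta1 = 0%N /\ beta2 = 0%N) -> chi h = 3 * om ^ (alpha%:Z * eps)) /\
     (~ (beta1 = 0%N /\ beta2 = 0%N) -> chi h = 0)) /\
  (sigma = 1%N ->
     (beta2 = 0%N -> chi h = om ^ (alpha%:Z * eps) * (-1) ^+ k) /\
     (beta2 = 1%N ->
        chi h = om ^ (alpha%:Z * eps) * (-1) ^+ k * om ^ (- (beta1%:Z * eps))) /\
     (beta2 = 2%N ->
        chi h = om ^ (alpha%:Z * eps) * (-1) ^+ k * om ^ (beta1%:Z * eps))).
Proof.
move=> om chi h.
have powE (n : nat) (e : int) : om ^ (n%:Z * e) = (om ^ e) ^+ n.
  by rewrite mulrC -exprz_exp.
have chiE : chi h = om ^ (alpha%:Z * eps) *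
    \tr (spin_xi1 R eps ^+ beta1 * spin_xi2 R ^+ beta2 * spin_w R k ^+ sigma).
  by rewrite /chi /h /trace_character spinR_normal_form mxtraceZ powE.
have simp := (mulmx3, tr_mx3, mulr0, mul0r, addr0, add0r, mulr1, mul1r).
(* Moving the sign onto [eps] makes the third phase a power of [om ^ (- eps)], a diagonal entry of
   [spin_xi1]. *)
rewrite chiE spin_xi1X -mulrN !powE; split=> [->|->].
  rewrite expr0 mulr1; split=> [[-> ->]|nz].
    by rewrite !expr0 !simp; ring.
  case: beta2 hbeta2 nz {h chiE} => [|[|[|]]] // _ nz.
  - rewrite expr0 mulr1 tr_mx3 omega_sum_exp ?mulr0 //.
    by rewrite hbeta1 andbT lt0n; apply/eqP => b0; apply: nz.
  - by rewrite expr1 /spin_xi2 !simp.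
  - by rewrite expr2 /spin_xi2 !simp.
(* The fixed basis vector is the middle one for [beta2 = 0], the third for 1 and the first for 2;
   the matching diagonal entry of the power of [spin_xi1] gives the phase. *)
rewrite expr1 /spin_w scale_mx3; split=> [->|].
  by rewrite expr0 mulr1 !simp.
split=> ->.
  by rewrite expr1 /spin_xi2 !simp -!mulrA; congr (_ * _); rewrite mulrC.
by rewrite expr2 /spin_xi2 !simp -!mulrA; congr (_ * _); rewrite mulrC.
Qed.
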